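(* Let $P$ be a finite antichain and $n=2$. Then the simplicial spheres $\Sigma(\mathcal{J})$ are the Bier spheres: if $\mathcal{J}$ is a non-empty poset ideal in $\mathrm{Hom}(P,[2])$ with $\mathcal{J}\neq\mathrm{Hom}(P,[2])$, and $X$ is the simplicial complex on $P$ corresponding to $\mathcal{J}$, then $\Sigma(\mathcal{J})$ is the Bier sphere associated with $X$.
   Context: $\Bbbk$ is a field, $[2]=\{1<2\}$. Since $P$ is an antichain, $\mathrm{Hom}(P,[2])$ is the set of all maps $P\to\{1,2\}$, with the pointwise order. A poset ideal is a down-closed subset. A poset ideal $\mathcal{J}$ in $\mathrm{Hom}(P,[2])$ corresponds to the simplicial complex $X=\{\phi^{-1}(2):\phi\in\mathcal{J}\}$ on the set $P$. In $\Bbbk[x_{P\times[2]}]$ (variables $x_{p,i}$, $p\in P$, $i\in\{1,2\}$) let $L(\mathcal{J})$ be the ideal generated by the monomials $\prod_{p\in P}x_{p,\phi(p)}$, $\phi\in\mathcal{J}$. The Alexander dual $I^A$ of a squarefree monomial ideal $I$ is the ideal spanned by all monomials which have a non-trivial common divisor with every monomial in $I$. $\Delta(\mathcal{J})$ is the simplicial complex on $P\times[2]$ with Stanley–Reisner ideal $L(\mathcal{J})^A$ (equivalently, with facets the complements of the graphs $\{(p,\phi(p)):p\in P\}$, $\phi\in\mathcal{J}$). For $\mathcal{J}$ non-empty and different from $\mathrm{Hom}(P,[2])$ it is a simplicial ball, and $\Sigma(\mathcal{J})$ denotes its boundary, the subcomplex whose facets are the codimension one faces of $\Delta(\mathcal{J})$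 contained in precisely one facet of $\Delta(\mathcal{J})$. For a simplicial complex $X$ on $P$, the Alexander dual complex is $X^A=\{G\subseteq P: P\setminus G\notin X\}$. The Bier sphere associated with $X$ is the simplicial complex on $P\times[2]$ whose Stanley–Reisner ideal in $\Bbbk[x_{P\times[2]}]$ is $I_X+I_{X^A}+(x_{p,1}x_{p,2})_{p\in P}$, where the Stanley–Reisner ideal $I_X$ of $X$ is written in the variables $x_{p,1}$ and the Stanley–Reisner ideal $I_{X^A}$ of $X^A$ is written in the variables $x_{p,2}$. *)

(* Defs.v *)
From mathcomp Require Import all_boot all_order all_algebra.
From mathcomp Require Import boolp.
From mathcomp Require Import mpoly.
Set Implicit Arguments.
Unset Strict Implicit.
Unset Printing Implicit Defensive.
Import Order.TTheory GRing.Theory.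
Local Open Scope ring_scope.

Section PolynomialRing.
Variables (k : fieldType) (T : finType).

(* k[x_T]: the variable attached to t : T has index enum_rank t. *)
Definition polyring := {mpoly k[#|T|]}.

Definition var (t : T) : polyring := 'X_(enum_rank t).

Definition ideal_gen (S : polyring -> Prop) (f : polyring) : Prop :=
  exists s : seq (polyring * polyring),
    (forall c, c \in s -> S c.2) /\ f = \sum_(c <- s) c.1 * c.2.

Definition ideal_add (I J : polyring -> Prop) (f : polyring) : Prop :=
  exists g h, [/\ I g, J h & f = g + h].

Definition alexander_dual_ideal (I : polyring -> Prop) : polyring -> Prop :=
  ideal_gen (fun f => exists2 m : 'X_{1..#|T|}, f = 'X_[m] &
    forall m' : 'X_{1..#|T|}, I 'X_[m'] ->
      exists d : 'X_{1..#|T|}, [/\ d != 0%MM, (d <= m)%MM & (d <= m')%MM]).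

End PolynomialRing.

(* Elements of T need not be vertices. *)
Definition simplicial_complex (T : finType) (X : {set {set T}}) : Prop :=
  forall F G : {set T}, F \in X -> G \subset F -> G \in X.

(* The Stanley-Reisner ideal of X, written in the variables x_(v t) of k[x_U]. *)
Definition SR_ideal_in (k : fieldType) (T U : finType) (v : T -> U)
    (X : {set {set T}}) : polyring k U -> Prop :=
  ideal_gen (fun f => exists2 F : {set T}, F \notin X &
                        f = \prod_(t in F) var k (v t)).

Definition SR_ideal (k : fieldType) (T : finType) (X : {set {set T}}) :
    polyring k T -> Prop :=
  SR_ideal_in (fun t : T => t) X.

Definition has_SR_ideal (k : fieldType) (T : finType) (X : {set {set T}})
    (I : polyring k T -> Prop) : Prop :=
  simplicial_complex X /\ forall f, SR_ideal X f <-> I f.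

(* The complex with Stanley-Reisner ideal I, for I a squarefree monomial
   ideal. *)
Definition SR_complex (k : fieldType) (T : finType)
    (I : polyring k T -> Prop) : {set {set T}} :=
  [set F : {set T} | ~~ `[< I (\prod_(t in F) var k t) >]].

Section Complexes.
Variable T : finType.
Implicit Types X : {set {set T}}.

Definition facets X : {set {set T}} :=
  [set F in X | [forall G in X, (F \subset G) ==> (G == F)]].

Definition codim1_faces X : {set {set T}} :=
  [set F in X | #|F|.+1 == (\max_(G in X) #|G|)%N].

Definition boundary X : {set {set T}} :=
  [set G : {set T} | [exists F in codim1_faces X,
     (G \subset F) && (#|[set H in facets X | F \subset H]| == 1)%N]].

Definition alexander_dual_complex X : {set {set T}} :=
  [set G : {set T} | ~: G \notin X].

End Complexes.

(* The chain [n] = {1 < ... < n} is 'I_n, i : 'I_n standing for i.+1. *)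
Definition one2 : 'I_2 := ord0.
Definition two2 : 'I_2 := ord_max.

Section Letterplace.
Variables (d : Order.disp_t) (P : finPOrderType d).

Definition antichain : Prop := forall p q : P, (p <= q)%O -> p = q.

Definition poset_hom (n : nat) : {set {ffun P -> 'I_n}} :=
  [set phi : {ffun P -> 'I_n} |
     [forall p, forall q, (p <= q)%O ==> (phi p <= phi q)%N]].

Definition poset_ideal (n : nat) (J : {set {ffun P -> 'I_n}}) : Prop :=
  J \subset poset_hom n /\
  forall phi psi, phi \in J -> psi \in poset_hom n ->
    (forall p, (psi p <= phi p)%N) -> psi \in J.

Definition L (k : fieldType) (n : nat) (J : {set {ffun P -> 'I_n}}) :
    polyring k (P * 'I_n)%type -> Prop :=
  ideal_gen (fun f => exists2 phi, phi \in J &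
                        f = \prod_(p : P) var k (p, phi p)).
Arguments L k {n} J f.

Definition Delta (k : fieldType) (n : nat) (J : {set {ffun P -> 'I_n}}) :
    {set {set P * 'I_n}} :=
  SR_complex (alexander_dual_ideal (L k J)).

Definition Sigma (k : fieldType) (n : nat) (J : {set {ffun P -> 'I_n}}) :
    {set {set P * 'I_n}} :=
  boundary (Delta k J).

Definition complex_of (J : {set {ffun P -> 'I_2}}) : {set {set P}} :=
  [set phi @^-1: [set two2] | phi : {ffun P -> 'I_2} in J].

End Letterplace.

Arguments poset_hom {d} P n.

Arguments L {d P} k {n} J f.

Definition bier_ideal (k : fieldType) (P : finType) (X : {set {set P}}) :
    polyring k (P * 'I_2)%type -> Prop :=
  ideal_add
    (ideal_add
       (SR_ideal_in (fun p => (p, one2)) X)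
       (SR_ideal_in (fun p => (p, two2)) (alexander_dual_complex X)))
    (ideal_gen (fun f => exists p : P,
       f = var k (p, one2) * var k (p, two2))).

Arguments bier_ideal k {P} X f.

Definition is_bier_sphere (k : fieldType) (P : finType) (X : {set {set P}})
    (S : {set {set P * 'I_2}}) : Prop :=
  has_SR_ideal S (bier_ideal k X).

Lemma ideal_gen_sub (k : fieldType) (T : finType) (S I : polyring k T -> Prop) :
  I 0 -> (forall f g, I f -> I g -> I (f + g)) ->
  (forall f g, I g -> I (f * g)) ->
  (forall f, S f -> I f) -> forall f, ideal_gen S f -> I f.
Proof.
move=> I0 ID IM SI f [s [sS ->]]; rewrite big_seq.
by apply: (big_ind I) => // c cs; apply: IM; apply: SI; apply: sS.
Qed.

Lemma ideal_gen_closed (k : fieldType) (T : finType) (S : polyring k T -> Prop) :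
  [/\ ideal_gen S 0,
      forall f g, ideal_gen S f -> ideal_gen S g -> ideal_gen S (f + g),
      forall f g, ideal_gen S g -> ideal_gen S (f * g) &
      forall f, S f -> ideal_gen S f].
Proof.
split.
- by exists [::]; rewrite big_nil.
- move=> f g [s [sS ->]] [t [tS ->]]; exists (s ++ t); rewrite big_cat.
  by split=> // c; rewrite mem_cat => /orP[/sS|/tS].
- move=> f g [s [sS ->]]; exists [seq (f * c.1, c.2) | c <- s]; split.
    by move=> c /mapP[c' /sS ? ->].
  by rewrite big_map big_distrr; apply: eq_bigr => c _; rewrite /= mulrA.
- move=> f Sf; exists [:: (1, f)]; rewrite big_seq1 mul1r; split=> // c.
  by rewrite inE => /eqP->.
Qed.

(* The Stanley-Reisner ideal of Delta k J is indeed the Alexander dual of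
   L k J. *)
Lemma has_SR_ideal_Delta (k : fieldType) (d : Order.disp_t)
    (P : finPOrderType d) (n : nat) (J : {set {ffun P -> 'I_n}}) :
  has_SR_ideal (Delta k J) (alexander_dual_ideal (L k J)).
Proof.
rewrite /Delta; move: (L k J) => I.
have [A0 AD AM Agen] := ideal_gen_closed (fun f => exists2 m : 'X_{1..#|{: P * 'I_n}|},
   f = 'X_[m] :> polyring k _ & forall m' : 'X_{1..#|{: P * 'I_n}|}, I 'X_[m'] ->
      exists d : 'X_{1..#|{: P * 'I_n}|}, [/\ d != 0%MM, (d <= m)%MM & (d <= m')%MM]).
have memC (F : {set P * 'I_n}) : F \notin SR_complex (alexander_dual_ideal I) ->
    alexander_dual_ideal I (\prod_(t in F) var k t).
  by rewrite inE negbK => /asboolP.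
split.
  move=> F G; rewrite !inE => FC GF; apply: contra FC => /asboolP IG.
  apply/asboolP; rewrite (big_setID G) (setIidPr GF) /= mulrC.
  exact: AM.
move=> f; split.
  by apply: ideal_gen_sub => // g [F FC ->]; apply: memC.
have [S0 SD SM Sgen] := ideal_gen_closed (fun f => exists2 F : {set P * 'I_n},
   F \notin SR_complex (alexander_dual_ideal I) & f = \prod_(t in F) var k t).
apply: ideal_gen_sub => // _ [m -> hm].
pose F := [set t | m (enum_rank t) != 0%N].
pose mF := (\sum_(t in F) U_(enum_rank t))%MM : 'X_{1..#|{: P * 'I_n}|}.
have XF : 'X_[mF] = \prod_(t in F) var k t by rewrite -mprodXE.
have mFE i : mF i = (m i != 0%N).
  rewrite mnm_sumE; under eq_bigr do rewrite mnm1E.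
  rewrite -[i]enum_valK; set t := enum_val i.
  under eq_bigr do rewrite (inj_eq enum_rank_inj).
  case: (boolP (t \in F)) => tF.
    rewrite (bigD1 t) //= eqxx big1 ?addn0; last by move=> ? /andP[_ /negPf->].
    by move: tF; rewrite inE => ->.
  rewrite big1; first by move: tF; rewrite inE => /negPf->.
  by move=> s sF; case: eqVneq => // st; rewrite -st sF in tF.
have mFm : (mF <= m)%MM.
  by apply/mnm_lepP => i; rewrite mFE; case: (m i).
have -> : 'X_[m] = 'X_[(m - mF)%MM] * 'X_[mF] :> polyring k _.
  by rewrite -mpolyXD submK.
apply: SM; rewrite XF; apply: Sgen; exists F => //.
rewrite inE negbK; apply/asboolP; rewrite -XF; apply: Agen; exists mF => //.
move=> m' /hm [e [e0 em em']].
have [i ei] : exists i, e i != 0%N.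
  apply/existsP; apply: contraR e0 => /existsPn h; apply/eqP/mnmP => i.
  by rewrite mnm0E; move: (h i); rewrite negbK => /eqP.
have lt0 (u : 'X_{1..#|{: P * 'I_n}|}) : (0 < u i)%N -> (U_(i) <= u)%MM.
  by move=> ui; apply/mnm_lepP => j; rewrite mnm1E; case: eqP => // <-.
have ei0 : (0 < e i)%N by rewrite lt0n.
move/mnm_lepP/(_ i): em => em; move/mnm_lepP/(_ i): em' => em'.
exists U_(i)%MM; split.
- by apply/eqP => /mnmP/(_ i); rewrite mnm1E mnm0E eqxx.
- by apply: lt0; rewrite mFE -lt0n (leq_trans ei0 em).
- by apply: lt0; rewrite (leq_trans ei0 em').
Qed.

(* Main.v *)
(** Write [F1], [F2] for the layers [{p | (p, 1) \in F}], [{p | (p, 2) \in F}]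
of a set [F].  It is a face of [Delta J] iff it misses the graph of some [phi]
in [J], i.e. [F1 \subset A] and [F2 \subset ~: A] for some [A = phi^-1(2)] in
[X].  So the facets correspond to the members of [X], and a codimension one
face, where [~: F2 = p |: F1] for some [p] not in [F1], lies in the facet of
[F1], and also in that of [p |: F1] if the latter is in [X].  Hence a set is in
the boundary iff its layers can be enlarged to such [F1], [F2] with [F1] in [X]
and [p |: F1] not in [X]; taking [F1] maximal in [X] between the first layer and
the complement of the second, this is possible iff the layers are disjoint, the
first is in [X] and the complement of the second is not. *)
Require Import Defs.
From mathcomp Require Import all_boot all_order all_algebra.
From mathcomp Require Import boolp.
From mathcomp Require Import mpoly.
Set Implicit Arguments.
Unset Strict Implicit.
Unset Printing Implicit Defensive.
Import GRing.Theory.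
Local Open Scope ring_scope.

(** * Monomial ideals and Alexander duals of squarefree ones *)

Section MonomialIdeals.
Variables (k : fieldType) (T : finType).
Implicit Types (F G : {set T}) (m : 'X_{1..#|T|}).

Lemma mem_ideal_gen (S : polyring k T -> Prop) f : S f -> ideal_gen S f.
Proof. by have [_ _ _] := ideal_gen_closed S; apply. Qed.

(** Compare coefficients at [m]: some summand [c.1 * c.2] must have a nonzero one, and every
    monomial in the support of a multiple of ['X_[m']] is a multiple of [m']. *)
Lemma monomial_ideal_dvd (Q : 'X_{1..#|T|} -> Prop) m :
  ideal_gen (fun f : polyring k T => exists2 m', f = 'X_[m'] & Q m') 'X_[m] ->
  exists2 m', Q m' & (m' <= m)%MM.
Proof.
move=> [s [sQ /(congr1 (fun f : polyring k T => f@_m))]].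
rewrite mcoeffX eqxx raddf_sum /= => sum1.
have [/hasP [c cs cm] | /hasPn s0] :=
  boolP (has (fun c : polyring k T * polyring k T => (c.1 * c.2)@_m != 0) s).
- have [m' c2E Qm'] := sQ _ cs; exists m' => //.
  move: cm; rewrite c2E -mcoeff_msupp (perm_mem (msuppMX _ _)).
  by move=> /mapP [m'' _ ->]; apply: lem_addr.
- move: sum1; rewrite big_seq big1 => [/eqP|c /s0]; first by rewrite oner_eq0.
  by rewrite negbK => /eqP.
Qed.

Definition mset F : 'X_{1..#|T|} := (\sum_(t in F) U_(enum_rank t))%MM.

Lemma mpolyX_mset F : 'X_[mset F] = \prod_(t in F) var k t.
Proof. by rewrite -mprodXE. Qed.

Lemma msetE F t : mset F (enum_rank t) = (t \in F).
Proof.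
rewrite mnm_sumE big_mkcond (bigD1 t) //= mnm1E eqxx big1 ?addn0 => [|s st].
  by case: (t \in F).
by rewrite mnm1E (inj_eq enum_rank_inj) (negPf st) if_same.
Qed.

Lemma common_divisor_mset F G :
  (exists e : 'X_{1..#|T|}, [/\ e != 0%MM, (e <= mset F)%MM & (e <= mset G)%MM])
  <-> F :&: G != set0.
Proof.
split=> [[e [e0 eF eG]]|/set0Pn [t /setIP [tF tG]]].
- apply: contraNneq e0 => FG0; apply/eqP/mnmP => i; rewrite mnm0E.
  rewrite -[i]enum_valK; set t := enum_val i.
  move/mnm_lepP/(_ (enum_rank t)): eF; move/mnm_lepP/(_ (enum_rank t)): eG.
  have /negPf : t \notin F :&: G by rewrite FG0 inE.
  rewrite !msetE inE; case: (t \in F) => /=; last by move=> _ _; case: (e _).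
  by move=> ->; case: (e _).
- have U_mset (A : {set T}) : t \in A -> (U_(enum_rank t) <= mset A)%MM.
    move=> tA; apply/mnm_lepP => i; rewrite mnm1E.
    by case: eqP => // <-; rewrite msetE tA.
  exists U_(enum_rank t)%MM; split; try exact: U_mset.
  by apply/eqP => /mnmP/(_ (enum_rank t)); rewrite mnm1E mnm0E eqxx.
Qed.

(** Testing against the generators suffices: every monomial of the ideal is a multiple of some
    [mset G], and a common divisor with [mset G] also divides its multiples. Divisibility thus
    becomes intersection of sets. *)
Lemma alexander_dual_squarefree (C : {set T} -> Prop) F :
  alexander_dual_ideal
    (ideal_gen (fun f => exists2 G, C G & f = \prod_(t in G) var k t))
    (\prod_(t in F) var k t) <->
  forall G, C G -> F :&: G != set0.
Proof.
rewrite -mpolyX_mset; split.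
- move=> /monomial_ideal_dvd [m hm mF] G CG.
  have [|e [e0 em eG]] := hm (mset G).
    by apply: mem_ideal_gen; exists G; rewrite ?mpolyX_mset.
  by apply/common_divisor_mset; exists e; split=> //; apply: lepm_trans mF.
- move=> FC; apply: mem_ideal_gen; exists (mset F) => // m CIm.
  have [M0 MD MM _] := ideal_gen_closed (fun f : polyring k T => exists2 m',
    f = 'X_[m'] & exists2 G, C G & m' = mset G).
  have [_ [G CG ->] Gm] : exists2 m' : 'X_{1..#|T|},
      (exists2 G, C G & m' = mset G) & (m' <= m)%MM.
    apply: monomial_ideal_dvd; move: CIm; apply: ideal_gen_sub => // _ [G CG ->].
    by apply: mem_ideal_gen; exists (mset G); [rewrite mpolyX_mset | exists G].
  have /common_divisor_mset [e [e0 eF eG]] := FC _ CG.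
  by exists e; split=> //; apply: lepm_trans Gm.
Qed.

End MonomialIdeals.

(** * Sums of ideals and their closure properties *)

Section Ideals.
Variables (k : fieldType) (T : finType).
Implicit Types (I J K : polyring k T -> Prop) (f g : polyring k T).

Definition is_ideal I : Prop :=
  [/\ I 0, forall f g, I f -> I g -> I (f + g) & forall f g, I g -> I (f * g)].

Lemma ideal_gen_is_ideal (S : polyring k T -> Prop) : is_ideal (ideal_gen S).
Proof. by have [] := ideal_gen_closed S. Qed.

Lemma ideal_add_is_ideal I J :
  is_ideal I -> is_ideal J -> is_ideal (ideal_add I J).
Proof.
move=> [I0 ID IM] [J0 JD JM]; split.
- by exists 0, 0; rewrite addr0.
- move=> _ _ [f1 [g1 [If1 Jg1 ->]]] [f2 [g2 [If2 Jg2 ->]]].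
  by exists (f1 + f2), (g1 + g2); rewrite addrACA; split; [apply: ID|apply: JD|].
- move=> f _ [f1 [g1 [If1 Jg1 ->]]].
  by exists (f * f1), (f * g1); rewrite mulrDr; split; [apply: IM|apply: JM|].
Qed.

Lemma ideal_addl I J f : is_ideal J -> I f -> ideal_add I J f.
Proof. by move=> [J0 _ _] If; exists f, 0; rewrite addr0. Qed.

Lemma ideal_addr I J f : is_ideal I -> J f -> ideal_add I J f.
Proof. by move=> [I0 _ _] Jf; exists 0, f; rewrite add0r. Qed.

Lemma ideal_add_sub I J K : is_ideal K -> (forall f, I f -> K f) ->
  (forall f, J f -> K f) -> forall f, ideal_add I J f -> K f.
Proof. by move=> [_ KD _] IK JK _ [f [g [/IK Kf /JK Kg ->]]]; apply: KD. Qed.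

Lemma ideal_prod_var_subset I (A B : {set T}) : is_ideal I -> A \subset B ->
  I (\prod_(t in A) var k t) -> I (\prod_(t in B) var k t).
Proof.
move=> [_ _ IM] AB IA; rewrite (big_setID A) (setIidPr AB) /= mulrC.
exact: IM.
Qed.

End Ideals.

Lemma ord2P (i : 'I_2) : i = one2 \/ i = two2.
Proof. by case: i => [[|[]]] // ?; [left|right]; apply: val_inj. Qed.

(** * Subsets of [P * 'I_2] described by their two layers *)

Section Layers.
Variable P : finType.
Implicit Types (A B : {set P}) (F G H : {set P * 'I_2}) (X : {set {set P}}).

Definition layer (i : 'I_2) F : {set P} := [set p | (p, i) \in F].

Lemma layerS i F G : F \subset G -> layer i F \subset layer i G.
Proof. by move=> /subsetP FG; apply/subsetP => p; rewrite !inE => /FG. Qed.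

(* The complement of the graph of the map sending A to 2 and ~: A to 1. *)
Definition cut A : {set P * 'I_2} :=
  [set t | (t.1 \in A) == (t.2 == one2)].

Lemma subset_cut F A :
  (F \subset cut A) = (layer one2 F \subset A) && (layer two2 F \subset ~: A).
Proof.
apply/subsetP/andP => [FA | [/subsetP F1 /subsetP F2] [p i]].
  by split; apply/subsetP => p; rewrite !inE => /FA; rewrite inE /=;
     case: (p \in A).
by case: (ord2P i) => -> Fp; rewrite inE /=;
   [rewrite F1 ?inE | have := F2 p; rewrite !inE => /(_ Fp)/negPf->].
Qed.

Lemma layer1_cut A : layer one2 (cut A) = A.
Proof. by apply/setP => p; rewrite !inE eqxx eqb_id. Qed.

Lemma layer2_cut A : layer two2 (cut A) = ~: A.
Proof. by apply/setP => p; rewrite !inE; case: (p \in A). Qed.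

Lemma cut_inj : injective cut.
Proof. by move=> A B AB; rewrite -(layer1_cut A) AB layer1_cut. Qed.

Lemma card_layers F : #|F| = (#|layer one2 F| + #|layer two2 F|)%N.
Proof.
have layerI i : #|layer i F| = #|[set t in F | t.2 == i]|.
  rewrite -(card_imset (mem (layer i F)) (f := fun p => (p, i))); last by move=> p q [].
  apply: eq_card => -[p j]; rewrite !inE /=; apply/imsetP/andP.
    by move=> [q]; rewrite inE => Fq [-> ->].
  by move=> [Fp /eqP <-]; exists p; rewrite ?inE.
rewrite !layerI -cardsUI [X in (_ + X)%N]eq_card0 ?addn0.
  apply: eq_card => -[p i]; rewrite !inE /=.
  by case: (ord2P i) => ->; rewrite ?andbT ?andbF ?orbF.
by move=> [p i]; rewrite !inE /=; case: (ord2P i) => ->; rewrite !andbF.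
Qed.

Lemma card_cut A : #|cut A| = #|P|.
Proof. by rewrite card_layers layer1_cut layer2_cut cardsC. Qed.

(** * The complex generated by the cuts, and its boundary *)

Definition cut_complex X : {set {set P * 'I_2}} :=
  [set F : {set P * 'I_2} | [exists A in X, F \subset cut A]].

(** The Bier sphere given by its faces. Each conjunct excludes one kind of generator of
    [bier_ideal]: those from [X], those from its Alexander dual ([~: layer two2 F \notin X] puts the
    second layer in the dual complex), and the products of the two variables at a point. *)
Definition bier_complex X : {set {set P * 'I_2}} :=
  [set F : {set P * 'I_2} | [&& layer one2 F \in X, ~: layer two2 F \notin X &
            layer one2 F \subset ~: layer two2 F]].

Lemma mem_cut_complex X A : A \in X -> cut A \in cut_complex X.
Proof. by move=> AX; rewrite inE; apply/existsP; exists A; rewrite AX /=. Qed.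

(** All cuts have [#|P|] elements, so none is properly contained in another. *)
Lemma facets_cut_complex X H :
  (H \in facets (cut_complex X)) = [exists A in X, H == cut A].
Proof.
apply/idP/existsP => [|[A /andP [AX /eqP ->]]].
- rewrite inE => /andP [].
  rewrite inE => /existsP [A /andP [AX HA]] /forallP /(_ (cut A)).
  rewrite mem_cut_complex //= HA /= => /eqP AH.
  by exists A; rewrite AX AH /=.
- rewrite inE mem_cut_complex //=; apply/forallP => G.
  apply/implyP; rewrite inE => /existsP [B /andP [_ GB]].
  apply/implyP => AG; rewrite eq_sym eqEcard AG /=.
  by rewrite card_cut -(card_cut B) subset_leq_card.
Qed.

Lemma max_card_cut_complex X :
  X != set0 -> (\max_(F in cut_complex X) #|F|)%N = #|P|.
Proof.
move=> /set0Pn [A AX]; apply/eqP; rewrite eqn_leq; apply/andP; split.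
  apply/bigmax_leqP => F; rewrite inE => /existsP [B /andP [_ FB]].
  by rewrite -(card_cut B) subset_leq_card.
by rewrite -[X in (X <= _)%N](card_cut A); apply: leq_bigmax_cond (mem_cut_complex AX).
Qed.

Lemma boundary_cut_complex X : simplicial_complex X -> X != set0 ->
  boundary (cut_complex X) = bier_complex X.
Proof.
move=> Xcx X0; apply/setP => G; rewrite inE; apply/existsP/idP.
- move=> [F /and3P []]; rewrite inE max_card_cut_complex //.
  move=> /andP [+ /eqP cardF] GF /cards1P [H FH].
  rewrite inE => /existsP [A /andP [AX]]; rewrite subset_cut => /andP [F1A F2A].
  (* Only one facet contains [F], so every cut by a member of [X] that contains [F] equals [H]. *)
  have facetF B : B \in X -> F \subset cut B -> cut B = H.
    move=> BX FB; apply/set1P; rewrite -FH inE FB facets_cut_complex andbT.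
    by apply/existsP; exists B; rewrite BX /=.
  have F1X : layer one2 F \in X := Xcx _ _ AX F1A.
  have F12 : layer one2 F \subset ~: layer two2 F.
    by apply: subset_trans F1A _; rewrite -setCS setCK.
  (* Otherwise the cuts at [layer one2 F] and at [~: layer two2 F] are both facets containing [F].
     They coincide, so the layers of [F] are complementary and [F] has [#|P|] elements, one too
     many. *)
  have F2X : ~: layer two2 F \notin X.
    apply/negP => F2X; have := facetF _ F2X.
    rewrite -(facetF _ F1X) ?subset_cut ?subxx ?setCK ?subxx ?F12; last first.
      by rewrite -setCS setCK.
    move=> /(_ isT) /cut_inj F2E; move: cardF.
    rewrite card_layers -F2E addnC cardsC => /eqP.
    by rewrite eqn_leq ltnn.
  rewrite inE (Xcx _ _ F1X (layerS _ GF)) /=; apply/andP; split.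
    apply: contra F2X => G2X; apply: Xcx G2X _.
    by rewrite setCS layerS.
  apply: subset_trans (layerS _ GF) (subset_trans F12 _).
  by rewrite setCS layerS.
- rewrite inE => /and3P [G1X G2X G12].
  (* Choose [A] maximal in [X] between [layer one2 G] and [~: layer two2 G]. The upper bound is not
     in [X], so it has a point [p] outside [A], and maximality keeps [p |: A] out of [X]. *)
  have [] := @maxset_exists _
    (fun A => (A \in X) && (A \subset ~: layer two2 G)) (layer one2 G).
    by rewrite G1X G12.
  move=> A /maxsetP [/andP [AX AG2] Amax] G1A.
  have /subsetPn [p pG2 pA] : ~~ (~: layer two2 G \subset A).
    by apply: contra G2X => /(Xcx _ _ AX).
  have pAX : p |: A \notin X.
    apply: contra pA => pAX; rewrite -(Amax (p |: A)) ?setU11 ?subsetUr //.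
    by rewrite pAX subUset sub1set pG2.
  (* Dropping one point of the facet [cut A] gives codimension one; [G] stays inside because [p] is
     not in its second layer. *)
  pose F := cut A :\ (p, two2).
  have pcut : (p, two2) \in cut A by rewrite inE /= (negPf pA).
  exists F; apply/and3P; split.
  + rewrite inE max_card_cut_complex // -(card_cut A) (cardsD1 (p, two2) (cut A)) pcut.
    rewrite eqxx andbT inE; apply/existsP; exists A.
    by rewrite AX subD1set.
  + rewrite subsetD1 subset_cut G1A -[layer two2 G]setCK setCS AG2 /=.
    by move: pG2; rewrite !inE.
  + apply/cards1P; exists (cut A); apply/setP => H.
    rewrite inE facets_cut_complex inE; apply/andP/eqP => [[]|->].
      move=> /existsP [B /andP [BX /eqP ->]].
      rewrite subset_cut => /andP [AB BA]; congr cut; apply/eqP.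
      have {}AB : A \subset B.
        apply: subset_trans AB; apply/subsetP => q qA.
        by rewrite !inE /= qA xpair_eqE andbF.
      (* Any facet [cut B] containing [F] has [B] between [A] and [p |: A]. If [p] were in [B], then
         [p |: A] would be in [X]; hence [B] is [A]. *)
      rewrite eqEsubset AB andbT; apply/subsetP => q qB.
      have [pB|pB] := boolP (p \in B).
        by case/negP: pAX; apply: Xcx BX _; rewrite subUset sub1set pB.
      apply: contraTT qB => qA; have [->//|qp] := eqVneq q p.
      have := subsetP BA q; rewrite !inE /= => -> //.
      by rewrite (negPf qA) xpair_eqE (negPf qp).
    split; last by rewrite subD1set.
    by apply/existsP; exists A; rewrite AX /=.
Qed.

(** * The Stanley-Reisner ideal of the Bier sphere *)

Lemma simplicial_bier_complex X :
  simplicial_complex X -> simplicial_complex (bier_complex X).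
Proof.
move=> Xcx F G; rewrite !inE => /and3P [F1 F2 F12] GF.
have F2G : ~: layer two2 F \subset ~: layer two2 G by rewrite setCS layerS.
apply/and3P; split; first exact: Xcx F1 (layerS _ GF).
  by apply: contra F2 => G2; apply: Xcx G2 F2G.
by apply: subset_trans (layerS _ GF) (subset_trans F12 F2G).
Qed.

Lemma layer_imset i A : layer i [set (p, i) | p in A] = A.
Proof.
apply/setP => p; rewrite inE; apply/imsetP/idP => [[q qA [->]] //|pA].
by exists p.
Qed.

Lemma imset_layer_subset i F : [set (p, i) | p in layer i F] \subset F.
Proof. by apply/subsetP => _ /imsetP [p + ->]; rewrite inE. Qed.

Lemma prod_var_layer (k : fieldType) i A :
  \prod_(p in A) var k (p, i) =
  \prod_(t in [set (p, i) | p in A]) var (T := (P * 'I_2)%type) k t.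
Proof. by rewrite big_imset //= => p q _ _ []. Qed.

Lemma prod_var_pair (k : fieldType) (p : P) :
  var k (p, one2) * var k (p, two2) =
  \prod_(t in [set (p, one2); (p, two2)]) var k t.
Proof. by rewrite big_setU1 ?big_set1 // inE xpair_eqE andbF. Qed.

(** Both ideals are generated by squarefree monomials, so it is enough to place the generators of
    each in the other. *)
Lemma bier_complex_SR (k : fieldType) X : simplicial_complex X ->
  is_bier_sphere k X (bier_complex X).
Proof.
move=> Xcx; split; first exact: simplicial_bier_complex.
set I1 := SR_ideal_in (k := k) (fun p => (p, one2)) X.
set I2 := SR_ideal_in (k := k) (fun p => (p, two2)) (alexander_dual_complex X).
set I3 := ideal_gen (fun f => exists p : P,
  f = var k (p, one2) * var k (p, two2)).
have id1 : is_ideal I1 := ideal_gen_is_ideal _.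
have id2 : is_ideal I2 := ideal_gen_is_ideal _.
have id3 : is_ideal I3 := ideal_gen_is_ideal _.
have idB : is_ideal (bier_ideal k X).
  by apply: ideal_add_is_ideal => //; apply: ideal_add_is_ideal.
have idS : is_ideal (SR_ideal (k := k) (bier_complex X)) := ideal_gen_is_ideal _.
have memS F : F \notin bier_complex X ->
    SR_ideal (bier_complex X) (\prod_(t in F) var k t).
  by move=> FB; apply: mem_ideal_gen; exists F.
move=> f; split.
- case: (idB) => B0 BD BM; apply: ideal_gen_sub => // _ [G GB ->].
  (* A nonface violates one of the three conditions, and the generator of the matching kind divides
     its monomial. *)
  have [G1X|G1X] := boolP (layer one2 G \in X); last first.
    apply: ideal_prod_var_subset (imset_layer_subset one2 G) _ => //.
    rewrite -prod_var_layer; apply: ideal_addl => //; apply: ideal_addl => //.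
    by apply: mem_ideal_gen; exists (layer one2 G).
  have [G2X|G2X] := boolP (~: layer two2 G \in X).
    apply: ideal_prod_var_subset (imset_layer_subset two2 G) _ => //.
    rewrite -prod_var_layer; apply: ideal_addl => //; apply: ideal_addr => //.
    by apply: mem_ideal_gen; exists (layer two2 G); rewrite // inE negbK.
  move: GB; rewrite inE G1X G2X /= => /subsetPn [p]; rewrite !inE negbK => p1 p2.
  apply: (@ideal_prod_var_subset _ _ _ [set (p, one2); (p, two2)]) => //.
    by rewrite subUset !sub1set p1.
  rewrite -prod_var_pair; apply: ideal_addr; first exact: ideal_add_is_ideal.
  by apply: mem_ideal_gen; exists p.
- case: (idS) => S0 SD SM.
  (* Conversely, the support of each of the three kinds of generators is a nonface. *)
  apply: ideal_add_sub => // [|g]; first apply: ideal_add_sub => // g;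
    apply: ideal_gen_sub => //.
  + move=> _ [F FX ->]; rewrite prod_var_layer; apply: memS.
    by rewrite inE layer_imset (negPf FX).
  + move=> _ [F + ->]; rewrite inE negbK => FX; rewrite prod_var_layer.
    by apply: memS; rewrite inE layer_imset FX andbF.
  + move=> _ [p ->]; rewrite prod_var_pair; apply: memS.
    rewrite inE !negb_and; apply/orP; right; apply/orP; right.
    by apply/subsetPn; exists p; rewrite !inE eqxx ?orbT.
Qed.

End Layers.

(** * From poset ideals of maps to the two-element chain to complexes on [P] *)

Section TwoChain.
Variables (d : Order.disp_t) (P : finPOrderType d).
Implicit Types (J : {set {ffun P -> 'I_2}}) (phi : {ffun P -> 'I_2}).

Definition graph phi : {set P * 'I_2} := [set (p, phi p) | p : P].

Lemma disjoint_graph_cut (F : {set P * 'I_2}) phi :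
  (F :&: graph phi == set0) = (F \subset cut (phi @^-1: [set two2])).
Proof.
have graphP p i : ((p, i) \in graph phi) = (i == phi p).
  by apply/imsetP/eqP => [[q _ [-> ->]] //|->]; exists p.
suff -> : cut (phi @^-1: [set two2]) = ~: graph phi.
  by rewrite setI_eq0 disjoints_subset.
apply/setP => -[p i]; rewrite !inE graphP.
by case: (ord2P i) (ord2P (phi p)) => -> [] ->.
Qed.

Lemma Delta_cut_complex (k : fieldType) J :
  Delta k J = cut_complex (complex_of J).
Proof.
(* The generators are rewritten as monomials of graphs, the form to which
   [alexander_dual_squarefree] applies. *)
have LE : L k J = ideal_gen (fun f => exists2 G,
    (exists2 phi, phi \in J & G = graph phi) & f = \prod_(t in G) var k t).
  congr ideal_gen; apply/funext => f; apply/propext.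
  have prodE phi : \prod_(p : P) var k (p, phi p) =
      \prod_(t in graph phi) var k t.
    by rewrite big_imset //= => p q _ _ [].
  split=> [[phi phiJ ->]|[_ [phi phiJ ->] ->]].
    by exists (graph phi) => //; exists phi.
  by exists phi; rewrite ?prodE.
apply/setP => F; rewrite !inE LE; apply/idP/existsP.
- move=> FD; apply/existsP; apply: contraNT FD => /existsPn FX.
  apply/asboolP/alexander_dual_squarefree => _ [phi phiJ ->].
  have := FX (phi @^-1: [set two2]).
  by rewrite disjoint_graph_cut imset_f.
- move=> [_ /andP [/imsetP [phi phiJ ->] Fphi]]; apply/asboolPn.
  move=> /alexander_dual_squarefree /(_ _ (ex_intro2 _ _ phi phiJ erefl)).
  by rewrite disjoint_graph_cut Fphi.
Qed.

Lemma complex_of_simplicial J :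
  antichain P -> poset_ideal J -> simplicial_complex (complex_of J).
Proof.
move=> antiP [_ Jdown] _ B /imsetP [phi phiJ ->] BA.
pose psi := [ffun p => if p \in B then two2 else one2].
have psiB : psi @^-1: [set two2] = B.
  by apply/setP => p; rewrite !inE ffunE; case: (p \in B).
rewrite -psiB imset_f //; apply: Jdown phiJ _ _.
  (* Comparable elements of an antichain are equal, so the map [psi] attached to any subset is
     monotone. *)
  by rewrite inE; apply/forallP => p; apply/forallP => q; apply/implyP => /antiP ->.
move=> p; rewrite ffunE; case: ifP => // pB.
by have := subsetP BA _ pB; rewrite !inE => /eqP ->.
Qed.

End TwoChain.

Theorem corollary5p3 (k : fieldType) (d : Order.disp_t) (P : finPOrderType d)
  (HP : antichain P) (J : {set {ffun P -> 'I_2}}) (HJ : poset_ideal J)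
  (J_neq0 : J <> set0) (J_neqHom : J <> poset_hom P 2) :
  is_bier_sphere k (complex_of J) (Sigma k J).
Proof.
have Xcx := complex_of_simplicial HP HJ.
rewrite /Sigma Delta_cut_complex boundary_cut_complex //.
  exact: bier_complex_SR.
by rewrite imset_eq0; apply/eqP.
Qed.
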